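(* Let $\mathfrak{C}$ be an $A$-coring, and assume that there exists $g\in\mathbf{Gal}(\mathfrak{C})$. Assume that either $A^g$ is a division ring and $A$ is a right (or left) IBN ring, or $A$ is a division ring. Then $$\mathbf{Gr}(\mathfrak{C})=\mathbf{Gal}(\mathfrak{C})=\{\alpha g\alpha^{-1}:\alpha\in U(A)\},$$ and, in particular, $\mathscr{D}^1(\mathfrak{C},g)=\{1\}$.
   Context: $K$ is a commutative ring and $A$ an (associative unital) $K$-algebra with group of units $U(A)$. An $A$-coring is an $A$-bimodule $\mathfrak{C}$ with $A$-bimodule maps $\Delta:\mathfrak{C}\to\mathfrak{C}\otimes_A\mathfrak{C}$ and $\varepsilon:\mathfrak{C}\to A$ satisfying the coassociativity and counit axioms. A grouplike element is $g\in\mathfrak{C}$ with $\Delta(g)=g\otimes_A g$ and $\varepsilon(g)=1$; $\mathbf{Gr}(\mathfrak{C})$ is the set of these. For $g\in\mathbf{Gr}(\mathfrak{C})$, $A^g=\{a\in A: ag=ga\}$. A grouplike $g$ is Galois if the canonical map $A\otimes_{A^g}A\to\mathfrak{C}$, $a\otimes a'\mapsto aga'$, is bijective; $\mathbf{Gal}(\mathfrak{C})$ is the set of Galois grouplike elements. The group $U(A)$ acts on $\mathbf{Gr}(\mathfrak{C})$ by $(\alpha,g)\mapsto\alpha g\alpha^{-1}$; $\mathscr{D}^1(\mathfrak{C},g)$ is the set of orbits, pointed by the orbit of $g$, and $\mathscr{D}^1(\mathfrak{C},g)=\{1\}$ means that there is only one orbit. $A$ is a right (resp. left) IBN ring if for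 $n,m\in\mathbb{N}$ an isomorphism $A^{(n)}\cong A^{(m)}$ of right (resp. left) $A$-modules (direct sums of copies of $A$) implies $n=m$. *)

(* Defs.v *)
From HB Require Import structures.
From mathcomp Require Import all_boot all_order all_algebra.
From mathcomp Require Import ring_quotient.
From mathcomp Require Import boolp classical_sets.
From mathcomp Require Import freeg.

Set Implicit Arguments.
Unset Strict Implicit.
Unset Printing Implicit Defensive.

Import GRing.Theory.
Local Open Scope classical_set_scope.
Local Open Scope quotient_scope.
Local Open Scope ring_scope.

(* [tensor ra la] is the tensor product of M and N over R, where R acts on M
   on the right by [ra] and on N on the left by [la]: the free abelian group
   on M * N modulo the subgroup [tensor_sub] generated by [tensor_gen].  No
   law is required of the two actions. *)
Section Tensor.
Context {R : Type} {M N : zmodType}.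
Variables (ra : M -> R -> M) (la : R -> N -> N).

Local Notation F := {freeg (M * N)%type / int}.

Inductive tensor_gen : F -> Prop :=
| TensorGenDl m m' n :
    tensor_gen (<< (m + m', n) >> - (<< (m, n) >> + << (m', n) >>))
| TensorGenDr m n n' :
    tensor_gen (<< (m, n + n') >> - (<< (m, n) >> + << (m, n') >>))
| TensorGenA m r n :
    tensor_gen (<< (ra m r, n) >> - << (m, la r n) >>).

Inductive tensor_sub : F -> Prop :=
| TensorSub0 : tensor_sub 0
| TensorSubG x : tensor_gen x -> tensor_sub x
| TensorSubB x y : tensor_sub x -> tensor_sub y -> tensor_sub (x - y).

Definition tensor_rel : {pred F} :=
  [pred x | `[< tensor_sub x >]].

Fact tensor_rel_closed : zmod_closed tensor_rel.
Proof.
split=> [|x y]; first by apply/asboolP; exact: TensorSub0.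
by move=> /asboolP hx /asboolP hy; apply/asboolP; exact: TensorSubB.
Qed.

HB.instance Definition _ :=
  GRing.isZmodClosed.Build F tensor_rel tensor_rel_closed.

Definition tensor : Type := Quotient.quot tensor_rel.
HB.instance Definition _ := GRing.Zmodule.on tensor.

Definition tens (m : M) (n : N) : tensor :=
  \pi_(Quotient.quot tensor_rel) (<< (m, n) >> : F).

Let tens_eq (x y : F) : tensor_gen (x - y) ->
  \pi_(Quotient.quot tensor_rel) x = \pi_(Quotient.quot tensor_rel) y.
Proof.
move=> xy; apply/eqmodP; rewrite /= Quotient.equivE.
by apply/asboolP; exact: TensorSubG.
Qed.

Let piD (x y : F) : \pi_(Quotient.quot tensor_rel) (x + y) =
  (\pi_(Quotient.quot tensor_rel) x : tensor) + \pi_(Quotient.quot tensor_rel) y.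
Proof. by rewrite [LHS]raddfD. Qed.

Lemma tensDl m m' n : tens (m + m') n = tens m n + tens m' n.
Proof. by rewrite /tens -piD; apply: tens_eq; exact: TensorGenDl. Qed.

Lemma tensDr m n n' : tens m (n + n') = tens m n + tens m n'.
Proof. by rewrite /tens -piD; apply: tens_eq; exact: TensorGenDr. Qed.

Lemma tensA m r n : tens (ra m r) n = tens m (la r n).
Proof. by apply: tens_eq; exact: TensorGenA. Qed.

Lemma tens0l n : tens 0 n = 0.
Proof. by apply: (addrI (tens 0 n)); rewrite -tensDl !addr0. Qed.

Lemma tensNl m n : tens (- m) n = - tens m n.
Proof. by apply: (addrI (tens m n)); rewrite -tensDl !subrr tens0l. Qed.

Lemma tens_seq (t : tensor) :
  exists s : seq (M * N), t = \sum_(p <- s) tens p.1 p.2.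
Proof.
pose P (t : tensor) := exists s : seq (M * N), t = \sum_(p <- s) tens p.1 p.2.
have PD t1 t2 : P t1 -> P t2 -> P (t1 + t2).
  by move=> [s1 ->] [s2 ->]; exists (s1 ++ s2); rewrite big_cat.
have PN t1 : P t1 -> P (- t1).
  move=> [s1 ->]; exists [seq (- p.1, p.2) | p <- s1].
  by rewrite big_map -sumrN; apply: eq_bigr => p _; rewrite tensNl.
have P0 : P 0 by exists [::]; rewrite big_nil.
have PM t1 n : P t1 -> P (t1 *+ n).
  by move=> P1; elim: n => [|n IH]; rewrite ?mulr0n // mulrS; exact: PD.
have PZ t1 (k : int) : P t1 -> P (t1 *~ k).
  by move=> P1; case: k => n; [exact: PM|exact/PN/PM].
have Ppi (x : F) : P (\pi_(Quotient.quot tensor_rel) x).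
  elim/freeg_ind_dom0: x => [|k [m n] D _ _ PD0]; first by rewrite raddf0.
  rewrite piD; apply: PD => //.
  have -> : << k *g (m, n) >> = (<< (m, n) >> : F) *~ k.
    by rewrite freegU_mulz intz.
  rewrite raddfMz; apply: PZ.
  by exists [:: (m, n)]; rewrite big_seq1.
by rewrite -[t]reprK; exact: Ppi.
Qed.

Lemma tensor_ind (P : tensor -> Prop) :
  (forall m n, P (tens m n)) -> P 0 ->
  (forall t1 t2, P t1 -> P t2 -> P (t1 + t2)) -> forall t, P t.
Proof.
move=> Pt P0 PD t; have [s ->] := tens_seq t.
by elim: s => [|p s IH]; rewrite ?big_nil // big_cons; apply: PD.
Qed.

Lemma tensor_ext (P : zmodType) (f g : {additive tensor -> P}) :
  (forall m n, f (tens m n) = g (tens m n)) -> f =1 g.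
Proof.
move=> fg; elim/tensor_ind => [||t1 t2 h1 h2]; rewrite ?raddf0 //.
by rewrite !raddfD h1 h2.
Qed.

Section Lift.
Context {P : zmodType}.

Record balanced (f : M -> N -> P) : Prop := Balanced {
  balancedDl : forall m m' n, f (m + m') n = f m n + f m' n;
  balancedDr : forall m n n', f m (n + n') = f m n + f m n';
  balancedA : forall m r n, f (ra m r) n = f m (la r n)
}.

(* The map sending tens m n to f m n; it is well defined and additive when f
   is balanced ([tens_liftE], [tens_lift_additive]). *)
Definition tens_lift (f : M -> N -> P) (t : tensor) : P :=
  fglift (fun p : M * N => f p.1 p.2 : zmodule P) (repr t).

Variable f : M -> N -> P.
Hypothesis fb : balanced f.

Let f' : M * N -> zmodule P := fun p => f p.1 p.2.

Let gl_pure m n : fglift f' << (m, n) >> = f m n.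
Proof. by rewrite liftU scale1r. Qed.

Let glB (x y : F) : fglift f' (x - y) = fglift f' x - fglift f' y.
Proof. exact: lift_is_additive. Qed.

Let gl0 : fglift f' (0 : F) = 0.
Proof. by have := glB 0 0; rewrite !subrr. Qed.

Let glN (x : F) : fglift f' (- x) = - fglift f' x.
Proof. by rewrite -sub0r glB gl0 sub0r. Qed.

Let glD (x y : F) : fglift f' (x + y) = fglift f' x + fglift f' y.
Proof. by rewrite -{1}[y]opprK glB glN opprK. Qed.

Let gl_sub (x : F) : tensor_sub x -> fglift f' x = 0.
Proof.
elim=> {x} [|x|y z _ hy _ hz]; first exact: gl0; last by rewrite glB hy hz subrr.
case=> [m m' n|m n n'|m r n].
- by rewrite glB glD !gl_pure (balancedDl fb) subrr.
- by rewrite glB glD !gl_pure (balancedDr fb) subrr.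
- by rewrite glB !gl_pure (balancedA fb) subrr.
Qed.

Let gl_repr (x : F) :
  tens_lift f (\pi_(Quotient.quot tensor_rel) x) = fglift f' x.
Proof.
apply/eqP; rewrite -subr_eq0 -[X in X == _]glB; apply/eqP/gl_sub.
have : repr (\pi_(Quotient.quot tensor_rel) x) = x
  %[mod Quotient.quot tensor_rel] by rewrite reprK.
by move/eqmodP; rewrite /= Quotient.equivE => /asboolP.
Qed.

Lemma tens_liftE m n : tens_lift f (tens m n) = f m n.
Proof. by rewrite gl_repr gl_pure. Qed.

Lemma tens_lift_additive : zmod_morphism (tens_lift f).
Proof.
move=> t u; rewrite -[t]reprK -[u]reprK.
rewrite -[X in tens_lift f X](raddfB (\pi_(Quotient.quot tensor_rel))).
by rewrite !gl_repr glB.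
Qed.

Lemma tens_lift0 : tens_lift f 0 = 0.
Proof. by have := tens_lift_additive 0 0; rewrite !subrr. Qed.

Lemma tens_liftD t u : tens_lift f (t + u) = tens_lift f t + tens_lift f u.
Proof.
have := tens_lift_additive (t + u) u.
by rewrite addrK => ->; rewrite subrK.
Qed.

End Lift.
End Tensor.

(* [ract] is the right action; as usual for bimodules over a K-algebra, the
   two actions of K coincide. *)
HB.mixin Record isBimodule (K : comPzRingType) (A : algType K) M
    & GRing.Lmodule A M := {
  ract : M -> A -> M;
  ractDl : forall x y a, ract (x + y) a = ract x a + ract y a;
  ractDr : forall x a b, ract x (a + b) = ract x a + ract x b;
  ractA : forall x a b, ract x (a * b) = ract (ract x a) b;
  ract1 : forall x, ract x 1 = x;
  ractZl : forall a x b, ract (a *: x) b = a *: ract x b;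
  ract_central : forall (k : K) x, ract x (k%:A) = k%:A *: x
}.

#[short(type="bimodType")]
HB.structure Definition Bimodule (K : comPzRingType) (A : algType K) :=
  {M of isBimodule K A M & GRing.Lmodule A M}.

Notation "x :* a" := (ract x a) : ring_scope.

Definition bimod_morphism (K : comPzRingType) (A : algType K)
    (M N : bimodType A) (f : M -> N) : Prop :=
  [/\ forall x y, f (x + y) = f x + f y,
      forall a x, f (a *: x) = a *: f x
    & forall x a, f (x :* a) = f x :* a].

Section RegularBimodule.
Variables (K : comPzRingType) (A : algType K).

Let regular_central (k : K) (x : A^o) : x * k%:A = k%:A *: x.
Proof. by rewrite -scalerAr mulr1 [RHS]mulr_algl. Qed.

HB.instance Definition _ := isBimodule.Build K A A^o
  (@mulrDl A) (@mulrDr A) (@mulrA A) (@mulr1 A)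
  (fun a x b => esym (mulrA a x b)) regular_central.

End RegularBimodule.

Section BimoduleTensor.
Variables (K : comPzRingType) (A : algType K) (M N : bimodType A).

Lemma ract0l (a : A) : (0 : M) :* a = 0.
Proof. by apply: (addrI (0 :* a)); rewrite -ractDl !addr0. Qed.

Definition btensor : Type :=
  tensor (fun (x : M) (a : A) => x :* a) (fun (a : A) (y : N) => a *: y).

HB.instance Definition _ := GRing.Zmodule.on btensor.

Definition btens (x : M) (y : N) : btensor := tens _ _ x y.

Lemma btensDl x x' y : btens (x + x') y = btens x y + btens x' y.
Proof. exact: tensDl. Qed.

Lemma btensDr x y y' : btens x (y + y') = btens x y + btens x y'.
Proof. exact: tensDr. Qed.

Lemma btensA x a y : btens (x :* a) y = btens x (a *: y).
Proof. exact: tensA. Qed.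

Lemma btensor_ind (P : btensor -> Prop) :
  (forall x y, P (btens x y)) -> P 0 ->
  (forall t u, P t -> P u -> P (t + u)) -> forall t, P t.
Proof. exact: tensor_ind. Qed.

Definition btens_lact (a : A) : btensor -> btensor :=
  tens_lift (fun x y => btens (a *: x) y).

Definition btens_ract (t : btensor) (a : A) : btensor :=
  tens_lift (fun x y => btens x (y :* a)) t.

Let lact_balanced (a : A) :
  balanced (fun (x : M) (b : A) => x :* b) (fun (b : A) (y : N) => b *: y)
    (fun x y => btens (a *: x) y).
Proof.
split=> [x x' y|x y y'|x b y]; first by rewrite scalerDr btensDl.
  by rewrite btensDr.
by rewrite -ractZl btensA.
Qed.

Let ract_balanced (a : A) :
  balanced (fun (x : M) (b : A) => x :* b) (fun (b : A) (y : N) => b *: y)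
    (fun x y => btens x (y :* a)).
Proof.
split=> [x x' y|x y y'|x b y]; first by rewrite btensDl.
  by rewrite ractDl btensDr.
by rewrite btensA ractZl.
Qed.

Let lactE a x y : btens_lact a (btens x y) = btens (a *: x) y.
Proof. exact: tens_liftE (lact_balanced a) x y. Qed.

Let ractE a x y : btens_ract (btens x y) a = btens x (y :* a).
Proof. exact: tens_liftE (ract_balanced a) x y. Qed.

Let lact0 a : btens_lact a 0 = 0.
Proof. exact: tens_lift0 (lact_balanced a). Qed.
Let lactD a (t u : btensor) :
  btens_lact a (t + u) = btens_lact a t + btens_lact a u.
Proof. exact: tens_liftD (lact_balanced a) t u. Qed.
Let ract0 a : btens_ract 0 a = 0.
Proof. exact: tens_lift0 (ract_balanced a). Qed.
Let ractD a (t u : btensor) :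
  btens_ract (t + u) a = btens_ract t a + btens_ract u a.
Proof. exact: tens_liftD (ract_balanced a) t u. Qed.

Let lactA a b (t : btensor) :
  btens_lact a (btens_lact b t) = btens_lact (a * b) t.
Proof.
elim/btensor_ind: t => [x y||t u ht hu]; rewrite ?lact0 //.
  by rewrite !lactE scalerA.
by rewrite !lactD ht hu.
Qed.

Let lact1 : left_id 1 btens_lact.
Proof.
elim/btensor_ind => [x y||t u ht hu]; rewrite ?lact0 //.
  by rewrite !lactE scale1r.
by rewrite !lactD ht hu.
Qed.

Let lactDr : right_distributive btens_lact +%R.
Proof. exact: lactD. Qed.

Let lactDl t : {morph btens_lact^~ t : a b / a + b}.
Proof.
move=> a b; elim/btensor_ind: t => [x y||t u ht hu]; rewrite ?lact0 ?addr0 //.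
  by rewrite !lactE scalerDl btensDl.
by rewrite !lactD ht hu addrACA.
Qed.

HB.instance Definition _ := GRing.Zmodule_isLmodule.Build A btensor
  lactA lact1 lactDr lactDl.

Let ractDra (t : btensor) a b :
  btens_ract t (a + b) = btens_ract t a + btens_ract t b.
Proof.
elim/btensor_ind: t => [x y||t u ht hu]; rewrite ?ract0 ?addr0 //.
  by rewrite !ractE ractDr btensDr.
by rewrite !ractD ht hu addrACA.
Qed.

Let ractAa (t : btensor) a b :
  btens_ract t (a * b) = btens_ract (btens_ract t a) b.
Proof.
elim/btensor_ind: t => [x y||t u ht hu]; rewrite ?ract0 //.
  by rewrite !ractE ractA.
by rewrite !ractD ht hu.
Qed.

Let ract1a (t : btensor) : btens_ract t 1 = t.
Proof.
elim/btensor_ind: t => [x y||t u ht hu]; rewrite ?ract0 //.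
  by rewrite !ractE ract1.
by rewrite !ractD ht hu.
Qed.

Let ractZla a (t : btensor) b :
  btens_ract (btens_lact a t) b = btens_lact a (btens_ract t b).
Proof.
elim/btensor_ind: t => [x y||t u ht hu]; rewrite ?(lact0, ract0) //.
  by rewrite !(ractE, lactE).
by rewrite !(lactD, ractD) ht hu.
Qed.

Let ract_centrala (k : K) (t : btensor) :
  btens_ract t (k%:A) = btens_lact (k%:A) t.
Proof.
elim/btensor_ind: t => [x y||t u ht hu]; rewrite ?(lact0, ract0) //.
  by rewrite ractE lactE ract_central -btensA ract_central.
by rewrite !(lactD, ractD) ht hu.
Qed.

HB.instance Definition _ := isBimodule.Build K A btensor
  (fun t u a => ractD a t u) ractDra ractAa ract1a ractZla ract_centrala.

Lemma btensZl a x y : a *: btens x y = btens (a *: x) y.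
Proof. exact: lactE. Qed.

Lemma btens_ractr x y a : btens x y :* a = btens x (y :* a).
Proof. exact: ractE. Qed.

End BimoduleTensor.

Notation "M ⊗ N" := (btensor M%type N%type) (at level 40) : type_scope.
Notation "x ⊗ y" := (btens x y) (at level 40) : ring_scope.

Section TensorMaps.
Variables (K : comPzRingType) (A : algType K).

Definition btens_map (M M' N N' : bimodType A) (f : M -> M') (g : N -> N') :
    M ⊗ N -> M' ⊗ N' :=
  tens_lift (fun x y => f x ⊗ g y).

Definition btens_assoc (M N P : bimodType A) :
    (M ⊗ N) ⊗ P -> M ⊗ (N ⊗ P) :=
  tens_lift (fun t z => tens_lift (fun x y => x ⊗ (y ⊗ z)) t).

Lemma btens_mapE (M M' N N' : bimodType A) (f : M -> M') (g : N -> N') x y :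
  bimod_morphism f -> bimod_morphism g ->
  btens_map f g (x ⊗ y) = f x ⊗ g y.
Proof.
move=> [fD fl fr] [gD gl gr]; apply: tens_liftE.
split=> [m m' n|m n n'|m a n].
- by rewrite fD btensDl.
- by rewrite gD btensDr.
- by rewrite fr gl btensA.
Qed.

Lemma btens_assocE (M N P : bimodType A) (x : M) (y : N) (z : P) :
  btens_assoc ((x ⊗ y) ⊗ z) = x ⊗ (y ⊗ z).
Proof.
have b1 (w : P) : balanced (fun (x : M) (a : A) => x :* a)
    (fun (a : A) (y : N) => a *: y) (fun (x : M) (y : N) => x ⊗ (y ⊗ w)).
  split=> [m m' n|m n n'|m a n]; first exact: btensDl.
    by rewrite btensDl btensDr.
  by rewrite btensA btensZl.
rewrite [LHS]tens_liftE ?(tens_liftE (b1 z)) //.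
split=> [t t' p|t p p'|t a p].
- exact: tens_liftD (b1 p) t t'.
- elim/btensor_ind: t => [m n||t u ht hu].
  + by rewrite !(tens_liftE (b1 _)) !btensDr.
  + by rewrite !(tens_lift0 (b1 _)) addr0.
  + by rewrite !(tens_liftD (b1 _)) ht hu addrACA.
- elim/btensor_ind: t => [m n||t u ht hu].
  + by rewrite btens_ractr !(tens_liftE (b1 _)) btensA.
  + by rewrite ract0l !(tens_lift0 (b1 _)).
  + by rewrite ractDl !(tens_liftD (b1 _)) ht hu.
Qed.

End TensorMaps.

HB.mixin Record isCoring (K : comPzRingType) (A : algType K) C
    & Bimodule K A C := {
  comul : C -> btensor C C;
  counit : C -> A;
  comul_bimod : bimod_morphism comul;
  counit_bimod : bimod_morphism (counit : C -> A^o);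
  comulA : forall c,
    btens_assoc (btens_map comul id (comul c)) = btens_map id comul (comul c);
  comul1l : forall c, tens_lift (fun x y => counit x *: y) (comul c) = c;
  comul1r : forall c, tens_lift (fun x y => x :* counit y) (comul c) = c
}.

#[short(type="coringType")]
HB.structure Definition Coring (K : comPzRingType) (A : algType K) :=
  {C of isCoring K A C & Bimodule K A C}.

Section Units.
Variable R : pzRingType.

Record runit := RUnit {
  runit_val :> R;
  runit_inv : R;
  runitK : runit_val * runit_inv = 1;
  runitVK : runit_inv * runit_val = 1
}.

End Units.

Section Rings.
Variable R : nzRingType.

Definition division_ring : Prop :=
  forall x : R, x != 0 -> exists y : R, x * y = 1 /\ y * x = 1.

Definition left_IBN : Prop :=
  forall (n m : nat) (f : {linear 'rV[R]_n -> 'rV[R]_m}),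
    bijective f -> n = m.

(* Right R-modules are left modules over the opposite ring R^c. *)
Definition right_IBN : Prop :=
  forall (n m : nat) (f : {linear 'rV[R^c]_n -> 'rV[R^c]_m}),
    bijective f -> n = m.

End Rings.

Section Grouplike.
Variables (K : comPzRingType) (A : algType K) (C : coringType A).
Implicit Types (g h : C) (a b : A) (u : runit A).

Definition grouplike g : Prop := comul g = g ⊗ g /\ counit g = 1 :> A.

Definition Gr : set C := [set g | grouplike g].

Definition cent g : {pred A} := [pred a | a *: g == g :* a].

Fact cent_subring_closed g : subring_closed (cent g).
Proof.
split=> [|a b|a b]; rewrite !inE; first by rewrite scale1r ract1.
  move=> /eqP ha /eqP hb.
  have hN : g :* (- b) = - (g :* b).
    apply: (addrI (g :* b)); rewrite -ractDr !subrr.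
    by apply: (addrI (g :* 0)); rewrite -ractDr !addr0.
  by rewrite scalerBl ha hb ractDr hN.
by move=> /eqP ha /eqP hb; rewrite -scalerA hb -ractZl ha ractA.
Qed.

HB.instance Definition _ g :=
  GRing.isSubringClosed.Build A (cent g) (cent_subring_closed g).

(* The subring A^g. *)
Record cent_ring g := CentRing { cent_val : A; _ : cent_val \in cent g }.

HB.instance Definition _ g := [isSub for @cent_val g].
HB.instance Definition _ g := [Choice of cent_ring g by <:].
HB.instance Definition _ g := [SubChoice_isSubNzRing of cent_ring g by <:].

(* The tensor product of A with itself over A^g. *)
Definition can_dom g : Type :=
  tensor (fun (a : A) (r : cent_ring g) => a * val r)
         (fun (r : cent_ring g) (a : A) => val r * a).

HB.instance Definition _ g := GRing.Zmodule.on (can_dom g).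

Definition can_map g : can_dom g -> C := tens_lift (fun a a' => a *: g :* a').

Lemma can_mapE g a a' : can_map (tens _ _ a a' : can_dom g) = a *: g :* a'.
Proof.
apply: tens_liftE; split=> [a1 a2 b|b a1 a2|b [r /= rP] b'].
- by rewrite scalerDl ractDl.
- by rewrite ractDr.
- by rewrite -scalerA (eqP rP) ractA !ractZl.
Qed.

Definition Gal : set C := [set g | grouplike g /\ bijective (@can_map g)].

Definition gconj u g : C := runit_val u *: g :* runit_inv u.

Lemma gconj_grouplike u g : grouplike g -> grouplike (gconj u g).
Proof.
move=> [hg eg].
have [_ cl cr] := @comul_bimod K A C; have [_ el er] := @counit_bimod K A C.
split; rewrite /gconj.
  by rewrite cr cl hg btensZl btens_ractr btensA -ractZl scalerA runitVK scale1r.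
by rewrite er el eg [LHS](_ : _ = runit_val u * 1 * runit_inv u) // mulr1 runitK.
Qed.

Definition conj_orbit g : set C := [set gconj u g | u in [set: runit A]].

(* D^1(C, g) is this set pointed at [conj_orbit g]. *)
Definition D1 : set (set C) := [set conj_orbit h | h in Gr].

End Grouplike.

Arguments Gr {K A} C.
Arguments Gal {K A} C.
Arguments D1 {K A} C.

(* Main.v *)
From HB Require Import structures.
Require Import Defs.
From mathcomp Require Import all_boot all_order all_algebra.
From mathcomp Require Import boolp classical_sets.
From mathcomp Require Import freeg.

(** Write B for A^g and let h be a grouplike element.  Since g is Galois, h is a
sum of n terms x_i g y_i; take n minimal.

The equation Delta(h) = h ⊗ h is exploited through left B-linear forms
phi : A -> B.  Such a form induces a left A-linear map Psi : C -> A sending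
a g a' to a phi(a') ([form_extension]), and applying c ⊗ d |-> c Psi(d) to both
sides of the equation gives h Psi(h) = Psi(h) g ([intertwiner_of_form]): each
phi produces an element a of A with h a = a g.  If such an a is a unit, then h
is the conjugate a g a^-1, so it remains to find a unit.

When B is a division ring, minimality of n makes the y_i left independent over
B, so there are forms taking prescribed 0-1 values on the y_i and each x_k is
itself an intertwiner, h x_k = x_k g ([minimal_intertwiner]).  Minimality also
makes the x_i right independent over B.  Evaluating the maps Psi on
x_i g = h x_i = sum_k x_k g (y_k x_i) then gives y_j x_i = delta_ij
([minimal_dual]), while the counit axiom gives sum_i x_i y_i = 1
([minimal_counit]).  Thus the row x and the column y are mutually inverse
matrices, and the invariant basis property forces n = 1, so x_0 is a unit.  If
instead A is a division ring, then so is B, and the nonzero element x_0 is a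
unit at once.

The existence of enough forms is linear algebra in arbitrary dimension over a
noncommutative division ring, obtained from Zorn's lemma
([exists_separating_form]).  Finally, conjugates of g are Galois because
a ⊗ a' |-> a u ⊗ u^-1 a' identifies the canonical maps of u g u^-1 and g
([gconj_Gal]). *)

Set Implicit Arguments.
Unset Strict Implicit.
Unset Printing Implicit Defensive.

Import GRing.Theory.
Local Open Scope classical_set_scope.
Local Open Scope ring_scope.

(** * Linear forms over a division ring *)

Section LinearForms.
Variables (D : nzRingType) (V : lmodType D).
Hypothesis divD : division_ring D.

Definition linear_combination_closed (X : set V) : Prop :=
  forall a u v, X u -> X v -> X (a *: u + v).

Lemma exists_maximal_avoiding (U : set V) (y : V) :
  U 0 -> linear_combination_closed U -> ~ U y ->
  exists W : set V, [/\ U `<=` W, linear_combination_closed W, ~ W y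
    & forall W', linear_combination_closed W' -> W `<=` W' -> ~ W' y ->
        W' `<=` W].
Proof.
move=> U0 Ulin Uy.
(* The condition X !=set0 lets the empty set, which is the union of the empty
     chain, satisfy P. *)
pose P (X : set V) :=
  [/\ linear_combination_closed X, X !=set0 -> U `<=` X & ~ X y].
have PU : P U by split=> [|_ u|].
have [|W [[Wlin WU Wy] Wmax]] := @Zorn_bigcup V P.
  move=> F FP Ftot; split.
  - move=> a u v [X FX Xu] [Y FY Yv].
    have [XY|YX] := Ftot X Y FX FY.
      exists Y => //; have [Ylin _ _] := FP _ FY.
      by apply: Ylin => //; apply: XY.
    exists X => //; have [Xlin _ _] := FP _ FX.
    by apply: Xlin => //; apply: YX.
  - move=> [v [X FX Xv]] u Uu; exists X => //.
    by have [_ XU _] := FP _ FX; apply: XU => //; exists v.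
  - by move=> [X FX Xy]; have [_ _] := FP _ FX; apply.
have [v Wv] : W !=set0.
  apply/set0P/eqP => W0; apply: (Wmax U) => //.
  by rewrite W0; split=> [x []|/(_ 0 U0)].
have UW : U `<=` W by apply: WU; exists v.
exists W; split=> // W' W'lin WW' W'y x W'x; apply: contrapT => Wx.
apply: (Wmax W'); first by split=> // /(_ x W'x).
by split=> // _ u /UW /WW'.
Qed.

(** The maximal W of [exists_maximal_avoiding] is a hyperplane complementary to
the line of y: if v is outside W, maximality puts y in W + D v, so that v lies
in W + D y.  The form is the coordinate along y, which is unique because y is
not in W. *)
Lemma exists_separating_form (U : set V) (y : V) :
  U 0 -> linear_combination_closed U -> ~ U y ->
  exists phi : {linear V -> D^o}, (forall u, U u -> phi u = 0) /\ phi y = 1.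
Proof.
move=> U0 Ulin Uy.
have [W [UW Wlin Wy Wmax]] := exists_maximal_avoiding U0 Ulin Uy.
have W0 : W 0 by apply: UW.
have WZ a u : W u -> W (a *: u).
  by move=> Wu; rewrite -[_ *: _]addr0; apply: Wlin.
have WB u v : W u -> W v -> W (u - v).
  by move=> Wu Wv; rewrite -scaleN1r addrC; apply: Wlin.
have uniq_coord c : W (c *: y) -> c = 0.
  move=> Wcy; apply: contrapT => /eqP c0; apply: Wy.
  by have [c' [_ c'c]] := divD c0; rewrite -[y]scale1r -c'c -scalerA; apply: WZ.
have coordP v : exists c : D, W (v - c *: y).
  pose W' : set V := [set w + c *: v | w in W & c in [set: D]].
  have [Wv|Wv] := pselect (W v); first by exists 0; rewrite scale0r subr0.
  have [w Ww [c _ ycv]] : W' y.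
    apply: contrapT => W'y; apply: Wv; apply: (Wmax W') => //.
    - move=> a _ _ [w1 Ww1 [c1 _ <-]] [w2 Ww2 [c2 _ <-]].
      exists (a *: w1 + w2); first exact: Wlin.
      exists (a * c1 + c2) => //.
      by rewrite scalerDr scalerDl scalerA addrACA.
    - by move=> w Ww; exists w => //; exists 0; rewrite // scale0r addr0.
    - by exists 0 => //; exists 1; rewrite // scale1r add0r.
  have c0 : c != 0.
    by apply/eqP => c0; apply: Wy; rewrite -ycv c0 scale0r addr0.
  have [c' [_ c'c]] := divD c0; exists c'.
  rewrite -ycv scalerDr scalerA c'c scale1r opprD addrCA subrr addr0 -scaleNr.
  exact: WZ.
have [phi phiP] := choice coordP.
have phiE v c : W (v - c *: y) -> phi v = c.
  move=> Wv; apply/eqP; rewrite -subr_eq0; apply/eqP/uniq_coord.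
  have := WB _ _ Wv (phiP v).
  by rewrite opprB addrC addrA subrK scalerBl.
have phi_lin : linear_for *:%R (phi : V -> D^o).
  move=> a u v; apply: phiE.
  rewrite [in X in W X]scalerDl opprD addrACA.
  by rewrite -[X in (X *: y)]/(a * phi u) -scalerA -scalerBr; apply: Wlin.
pose L := GRing.isLinear.Build D V (D^o : lmodType D) *:%R phi phi_lin.
pose Phi : {linear V -> D^o} := HB.pack (phi : V -> D^o) L.
exists Phi; split=> [u Uu|]; apply: phiE; last by rewrite scale1r subrr.
by rewrite scale0r subr0; apply: UW.
Qed.

Lemma exists_nonvanishing_form (v : V) :
  v != 0 -> exists phi : {linear V -> D^o}, phi v = 1.
Proof.
move=> /eqP v0.
have [||phi [_ phiv]] := @exists_separating_form [set 0] v _ _ v0.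
- by [].
- by move=> a _ _ -> ->; rewrite scaler0 addr0.
- by exists phi.
Qed.

(** The form separates y k from the span U of the other vectors.  The index k
is dropped with [fintype.lift k] so that the same shape of relation can be fed
to expressions of length n.-1. *)
Lemma exists_coordinate_form n (y : 'I_n -> V) (k : 'I_n) :
  ~ (exists c : 'I_n.-1 -> D, y k = \sum_j c j *: y (fintype.lift k j)) ->
  exists phi : {linear V -> D^o}, forall j, phi (y j) = (j == k)%:R.
Proof.
pose U : set V := [set v | exists c : 'I_n.-1 -> D,
  v = \sum_j c j *: y (fintype.lift k j)].
move=> yk; have [||//|phi [phiU phiy]] := @exists_separating_form U (y k).
- by exists (fun=> 0); rewrite big1 // => j _; rewrite scale0r.
- move=> a _ _ [c ->] [d ->]; exists (fun j => a * c j + d j).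
  rewrite scaler_sumr -big_split; apply: eq_bigr => j _ /=.
  by rewrite scalerDl scalerA.
exists phi => j; case: (unliftP k j) => [i ->|->]; last by rewrite eqxx.
rewrite eq_sym (negbTE (neq_lift _ _)); apply: phiU.
exists (fun i' => (i' == i)%:R).
rewrite (bigD1 i) //= eqxx scale1r big1 ?addr0 //.
by move=> i' /negbTE ->; rewrite scale0r.
Qed.

End LinearForms.

(** * Invariant basis number *)

Section InvariantBasisNumber.

Lemma left_IBN_invertible_mx (R : nzRingType) m n (X : 'M[R]_(m, n)) Y :
  left_IBN R -> X *m Y = 1%:M -> Y *m X = 1%:M -> m = n.
Proof.
move=> ibn XY YX; apply: (ibn m n (mulmxr X)).
by exists (mulmxr Y) => v /=; rewrite -mulmxA ?XY ?YX mulmx1.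
Qed.

(** The row x and the column y are mutually inverse matrices of sizes 1 x n and
n x 1.  For the right-handed property the same computation is made over the
opposite ring, where x and y exchange their roles. *)
Lemma IBN_dual_tuples (R : nzRingType) n (x y : 'I_n -> R) :
  right_IBN R \/ left_IBN R -> \sum_i x i * y i = 1 ->
  (forall i j, y j * x i = (i == j)%:R) -> n = 1%N.
Proof.
move=> ibn xy yx; apply/esym; case: ibn => [ibn|ibn].
- apply: (@left_IBN_invertible_mx R^c 1 n (\row_i y i) (\col_i x i)) => //.
    apply/matrixP => i j; rewrite !ord1 !mxE eqxx.
    by apply: etrans xy; apply: eq_bigr => k _; rewrite !mxE.
  apply/matrixP => i j; rewrite !mxE big_ord1 !mxE.
  by rewrite -[LHS]/(y j * x i) yx.
- apply: (@left_IBN_invertible_mx R 1 n (\row_i x i) (\col_i y i)) => //.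
    apply/matrixP => i j; rewrite !ord1 !mxE eqxx.
    by apply: etrans xy; apply: eq_bigr => k _; rewrite !mxE.
  by apply/matrixP => i j; rewrite !mxE big_ord1 !mxE yx eq_sym.
Qed.

End InvariantBasisNumber.

(** * Expressions in a coring with a Galois grouplike element *)

Section GaloisGrouplike.
Variables (K : comPzRingType) (A : algType K) (C : coringType A).
Implicit Types (c d g h : C) (a x y : A).

Lemma ract_sumr n (F : 'I_n -> A) c : c :* (\sum_i F i) = \sum_i c :* F i.
Proof.
apply: (big_morph (fun a => c :* a)) => [a b|]; first exact: ractDr.
by apply: (addrI (c :* 0)); rewrite -ractDr !addr0.
Qed.

Lemma ract_suml n (F : 'I_n -> C) a : (\sum_i F i) :* a = \sum_i F i :* a.
Proof.
apply: (big_morph (fun c => c :* a)) => [c d|]; first exact: ractDl.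
exact: ract0l.
Qed.

Section Restriction.
Variable g : C.

Lemma cent_ring_comm (b : cent_ring g) : val b *: g = g :* val b.
Proof. by apply/eqP; have := valP b; rewrite inE. Qed.

(** A as a left module over A^g, under a name carrying g because the module
structure depends on it. *)
Definition restriction (_ : C) : Type := A.
HB.instance Definition _ := GRing.Zmodule.on (restriction g).

Definition restriction_scale (b : cent_ring g) (v : restriction g) :
    restriction g :=
  (val b * v : A).

Fact restriction_scaleA b b' v :
  restriction_scale b (restriction_scale b' v) = restriction_scale (b * b') v.
Proof. exact: mulrA. Qed.

Fact restriction_scale1 : left_id 1 restriction_scale.
Proof. exact: mul1r. Qed.

Fact restriction_scaleDr : right_distributive restriction_scale +%R.
Proof. by move=> b v w; exact: mulrDr. Qed.

Fact restriction_scaleDl v : {morph restriction_scale^~ v : b b' / b + b'}.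
Proof. by move=> b b'; exact: mulrDl. Qed.

HB.instance Definition _ := GRing.Zmodule_isLmodule.Build (cent_ring g)
  (restriction g) restriction_scaleA restriction_scale1 restriction_scaleDr
  restriction_scaleDl.

Lemma can_balanced : balanced
  (fun (a : A) (r : cent_ring g) => a * val r)
  (fun (r : cent_ring g) (a : A) => val r * a)
  (fun a a' => a *: g :* a').
Proof.
split=> [a a' b|a b b'|a r b]; first by rewrite scalerDl ractDl.
  by rewrite ractDr.
by rewrite -scalerA cent_ring_comm ractA !ractZl.
Qed.

End Restriction.

Section Galois.
Variable g : C.
Hypothesis gGal : Gal C g.

Local Notation B := (cent_ring g).
Local Notation form := {linear restriction g -> (B^o)%type}.

Lemma Galois_expression c :
  exists n (x y : 'I_n -> A), c = \sum_i x i *: g :* y i.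
Proof.
have [_ [f fK canK]] := gGal.
have [s es] := tens_seq (f c).
exists (size s), (fun i => (tnth (in_tuple s) i).1).
exists (fun i => (tnth (in_tuple s) i).2).
rewrite -[LHS]canK es -(big_tnth _ _ _ xpredT (fun p => p.1 *: g :* p.2)).
elim: s {es} => [|p s IH].
  by rewrite !big_nil; exact: tens_lift0 (can_balanced g).
by rewrite !big_cons -IH -can_mapE; exact: tens_liftD (can_balanced g) _ _.
Qed.

Section FormExtension.
Variable phi : form.

(** Psi is the inverse of the canonical map A ⊗_B A -> C followed by
a ⊗ a' |-> a phi(a'), which is balanced because phi is left B-linear. *)
Lemma form_extension : exists Psi : C -> A,
  [/\ forall c d, Psi (c + d) = Psi c + Psi d,
      forall a c, Psi (a *: c) = a * Psi c &
      forall x y, Psi (x *: g :* y) = x * val (phi y)].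
Proof.
have [_ [f fK canK]] := gGal.
have bal : balanced
    (fun (a : A) (r : B) => a * val r) (fun (r : B) (a : A) => val r * a)
    (fun a a' : A => a * val (phi a')).
  split=> [a a' b|a b b'|a r b]; first by rewrite mulrDl.
    by rewrite -mulrDr -rmorphD -raddfD.
  rewrite -mulrA; congr (_ * _).
  by rewrite -[val r * b]/(r *: (b : restriction g)) linearZ.
have canD t u : can_map (g := g) (t + u) = can_map t + can_map u.
  exact: tens_liftD (can_balanced g) t u.
have fD c d : f (c + d) = f c + f d.
  by rewrite -{1}[c]canK -{1}[d]canK -canD fK.
pose Psi c : A := tens_lift (fun a a' : A => a * val (phi a')) (f c).
have PsiD c d : Psi (c + d) = Psi c + Psi d.
  by rewrite /Psi fD; exact: tens_liftD bal _ _.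
have PsiE x y : Psi (x *: g :* y) = x * val (phi y).
  by rewrite /Psi -can_mapE fK; exact: tens_liftE bal _ _.
have Psi0 : Psi 0 = 0 by apply: (addrI (Psi 0)); rewrite -PsiD !addr0.
exists Psi; split=> // a c.
have [n [x [y ->]]] := Galois_expression c.
rewrite scaler_sumr !(big_morph Psi PsiD Psi0) mulr_sumr.
by apply: eq_bigr => i _; rewrite -ractZl scalerA !PsiE mulrA.
Qed.

End FormExtension.

Section Grouplike.
Variable h : C.
Hypothesis hgr : grouplike h.

Lemma comul_generator x y : comul (x *: g :* y) = (x *: g) ⊗ (g :* y).
Proof.
have [[hg _] _] := gGal; have [_ cl cr] := @comul_bimod K A C.
by rewrite cr cl hg btensZl btens_ractr.
Qed.

(** Here a is Psi(h) for the extension Psi of phi.  The two sides are the images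
under c ⊗ d |-> c Psi(d) of h ⊗ h and of Delta(h), the latter computed from
Delta(x g y) = x g ⊗ g y; this map is well defined on C ⊗_A C since Psi is left
A-linear. *)
Lemma intertwiner_of_form n (x y : 'I_n -> A) (phi : form) :
  h = \sum_i x i *: g :* y i ->
  let a := \sum_i x i * val (phi (y i)) in h :* a = a *: g.
Proof.
move=> hE a; have [Psi [PsiD PsiZ PsiE]] := form_extension phi.
have Psi0 : Psi 0 = 0 by apply: (addrI (Psi 0)); rewrite -PsiD !addr0.
have bal : balanced (fun (c : C) b => c :* b) (fun b (d : C) => b *: d)
    (fun c d => c :* Psi d).
  by split=> *; rewrite ?ractDl ?PsiD ?ractDr ?PsiZ ?ractA.
pose T : C ⊗ C -> C := tens_lift (fun c d => c :* Psi d).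
have TE c d : T (c ⊗ d) = c :* Psi d by exact: tens_liftE bal c d.
have TD t u : T (t + u) = T t + T u by exact: tens_liftD bal t u.
have T0 : T 0 = 0 by exact: tens_lift0 bal.
have [comulD _ _] := @comul_bimod K A C.
have comul0 : comul (0 : C) = 0.
  by apply: (addrI (comul 0)); rewrite -comulD !addr0.
have ha : Psi h = a.
  by rewrite hE (big_morph Psi PsiD Psi0); apply: eq_bigr.
have [hh _] := hgr.
transitivity (T (comul h)); first by rewrite hh TE ha.
rewrite {1}hE (big_morph _ comulD comul0) (big_morph T TD T0) scaler_suml.
apply: eq_bigr => i _.
rewrite comul_generator TE -[g :* y i]scale1r -ractZl PsiE mul1r.
by rewrite ractZl -cent_ring_comm scalerA.
Qed.

Hypothesis divB : division_ring (cent_ring g).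

(** * Minimal expressions of a grouplike element *)

Definition minimal_expression n (x y : 'I_n -> A) : Prop :=
  h = \sum_i x i *: g :* y i /\
  forall m (x' y' : 'I_m -> A), h = \sum_i x' i *: g :* y' i -> (n <= m)%N.

Lemma exists_minimal_expression :
  exists n (x y : 'I_n -> A), minimal_expression x y.
Proof.
pose P n := `[< exists x y : 'I_n -> A, h = \sum_i x i *: g :* y i >].
have exP : exists n, P n.
  have [n [x [y hE]]] := Galois_expression h.
  by exists n; apply/asboolP; exists x, y.
case: (ex_minnP exP) => n /asboolP [x [y hE]] nmin; exists n, x, y; split=> //.
by move=> m x' y' hE'; apply: nmin; apply/asboolP; exists x', y'.
Qed.

Section Minimal.
Variables (n : nat) (x y : 'I_n -> A).
Hypothesis xy_min : minimal_expression x y.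

Let no_shorter (x' y' : 'I_n.-1 -> A) (k : 'I_n) :
  h <> \sum_j x' j *: g :* y' j.
Proof.
have [_ hmin] := xy_min; move=> /hmin.
by case: n k => [[]//|m _]; rewrite ltnn.
Qed.

(** A relation would let the term of index k be absorbed by the others, since
elements of B move across g. *)
Lemma minimal_right_free (k : 'I_n) : ~ exists b : 'I_n.-1 -> B,
  (y k : restriction g) = \sum_j b j *: (y (fintype.lift k j) : restriction g).
Proof.
move=> [b yk].
pose x' j := x (fintype.lift k j) + x k * val (b j).
apply: (@no_shorter x' (fun j => y (fintype.lift k j)) k).
have [hE _] := xy_min; rewrite {1}hE (bigD1_ord k) //= yk.
rewrite [X in X + _]ract_sumr -big_split; apply: eq_bigr => j _ /=.
rewrite -[X in _ :* X]/(val (b j) * y (fintype.lift k j)) ractA ractZl -cent_ring_comm.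
by rewrite scalerA addrC -ractDl -scalerDl.
Qed.

(** A nonzero coefficient b k would be invertible, so x k could be expressed by
the other x j and the term of index k absorbed. *)
Lemma minimal_left_free (b : 'I_n -> B) :
  \sum_j x j * val (b j) = 0 -> forall k, b k = 0.
Proof.
move=> xb0 k; apply: contrapT => /eqP bk0.
have [b' [bkb' _]] := divB bk0.
have [c xk] : exists c : 'I_n.-1 -> B,
    x k = \sum_j x (fintype.lift k j) * val (c j).
  exists (fun j => - (b (fintype.lift k j) * b')).
  have : (\sum_j x j * val (b j)) * val b' = 0 by rewrite xb0 mul0r.
  rewrite mulr_suml (bigD1_ord k) //.
  rewrite -mulrA -rmorphM bkb' rmorph1 mulr1 => /eqP.
  rewrite addr_eq0 => /eqP ->; rewrite -sumrN; apply: eq_bigr => j _.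
  by rewrite rmorphN rmorphM mulrN mulrA.
pose y' j := val (c j) * y k + y (fintype.lift k j).
apply: (@no_shorter (fun j => x (fintype.lift k j)) y' k).
have [hE _] := xy_min; rewrite {1}hE (bigD1_ord k) //= xk.
rewrite scaler_suml [X in X + _]ract_suml -big_split; apply: eq_bigr => j _ /=.
by rewrite -scalerA cent_ring_comm ractZl ractZl -ractA -ractZl -ractZl -ractDr.
Qed.

(** The coordinate form at y k turns sum_i x_i phi(y_i) into x k. *)
Lemma minimal_intertwiner k : h :* x k = x k *: g.
Proof.
have [phi phiy] := exists_coordinate_form divB (@minimal_right_free k).
have [hE _] := xy_min; have := intertwiner_of_form phi hE.
rewrite /= (bigD1 k) //= phiy eqxx rmorph1 mulr1 big1 ?addr0 //.
by move=> j /negbTE jk; rewrite phiy jk rmorph0 mulr0.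
Qed.

(** If y_j x_i - delta_ij were nonzero, some form phi would be 1 on it.  But
applying Psi to h x_i = x_i g gives
sum_k x_k phi(y_k x_i - delta_ik) = 0, and independence of the x_k makes all
these values of phi vanish. *)
Lemma minimal_dual i j : y j * x i = (i == j)%:R.
Proof.
apply/eqP; rewrite -subr_eq0; apply: contrapT => /negP d0.
have [phi phid] := @exists_nonvanishing_form _ (restriction g) divB _ d0.
have [Psi [PsiD PsiZ PsiE]] := form_extension phi.
have Psi0 : Psi 0 = 0 by apply: (addrI (Psi 0)); rewrite -PsiD !addr0.
have [hE _] := xy_min.
pose d k : restriction g := y k * x i - (i == k)%:R.
suff /minimal_left_free/(_ j) : \sum_k x k * val (phi (d k)) = 0.
  by rewrite phid => /eqP; rewrite oner_eq0.
transitivity (Psi (h :* x i) - Psi (x i *: g :* 1)); last first.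
  by rewrite minimal_intertwiner ract1 subrr.
rewrite hE ract_suml (big_morph Psi PsiD Psi0).
rewrite PsiE [X in _ - X](_ : _ = \sum_k x k * val (phi ((i == k)%:R : A))).
  rewrite -sumrB; apply: eq_bigr => k _.
  by rewrite -ractA PsiE -mulrBr -rmorphB -raddfB.
rewrite (bigD1 i) // eqxx big1; first by rewrite /= addr0.
move=> k /negbTE.
by rewrite eq_sym => ->; rewrite raddf0 rmorph0 mulr0.
Qed.

Lemma minimal_counit : \sum_i x i * y i = 1.
Proof.
have [hE _] := xy_min; have [_ <-] := hgr; have [[_ eg] _] := gGal.
have [eD el er] := @counit_bimod K A C.
have e0 : counit (0 : C) = 0 :> A^o.
  by apply: (addrI (counit (0 : C) : A^o)); rewrite -eD !addr0.
rewrite hE (big_morph (counit : C -> A^o) eD e0); apply: eq_bigr => i _.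
by rewrite er el eg -[RHS]/(x i * 1 * y i) mulr1.
Qed.

End Minimal.

(** * From minimal expressions to conjugating units *)

Lemma conjugate_of_intertwiner (u : runit A) :
  h :* runit_val u = runit_val u *: g -> h = gconj u g.
Proof. by move=> hu; rewrite /gconj -hu -ractA runitK ract1. Qed.

Lemma grouplike_conjugate_IBN : right_IBN A \/ left_IBN A ->
  exists u : runit A, h = gconj u g.
Proof.
move=> ibn; have [n [x [y xy_min]]] := exists_minimal_expression.
have xy := minimal_counit xy_min; have yx := minimal_dual xy_min.
have n1 := IBN_dual_tuples ibn xy yx; subst n.
move: xy; rewrite big_ord1 => xy.
exists (RUnit xy (yx ord0 ord0)).
apply: conjugate_of_intertwiner; exact: minimal_intertwiner xy_min _.
Qed.

Lemma grouplike_conjugate_division : division_ring A ->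
  exists u : runit A, h = gconj u g.
Proof.
move=> divA; have [n [x [y xy_min]]] := exists_minimal_expression.
have xy := minimal_counit xy_min; have yx := minimal_dual xy_min.
case: n => [|n] in x y xy_min xy yx *.
  by move: xy; rewrite big_ord0 => /eqP; rewrite eq_sym oner_eq0.
have x0 : x ord0 != 0.
  apply/eqP => x0; have := yx ord0 ord0.
  by rewrite x0 mulr0 => /eqP; rewrite eq_sym oner_eq0.
have [x' [xx' x'x]] := divA _ x0; exists (RUnit xx' x'x).
apply: conjugate_of_intertwiner; exact: minimal_intertwiner xy_min _.
Qed.

End Grouplike.
End Galois.

(** Inverting a g = g a shows that the inverse of a also commutes with g. *)
Lemma division_ring_cent g : division_ring A -> division_ring (cent_ring g).
Proof.
move=> divA b b0; have vb0 : val b != 0 by rewrite -(inj_eq val_inj) in b0.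
have [a [ba ab]] := divA _ vb0.
have aP : a \in cent g.
  rewrite inE; apply/eqP.
  by rewrite -[g in LHS]ract1 -ba ractA -cent_ring_comm -ractZl scalerA ab scale1r.
by exists (CentRing aP); split; apply: val_inj.
Qed.

(** * Conjugation preserves Galois grouplike elements *)

Section Units.
Implicit Types u v : runit A.

Definition runit_swap u : runit A := RUnit (runitVK u) (runitK u).

Fact runit_mulK u v :
  (runit_val u * runit_val v) * (runit_inv v * runit_inv u) = 1.
Proof. by rewrite mulrA -[X in X * _]mulrA runitK mulr1 runitK. Qed.

Fact runit_mulVK u v :
  (runit_inv v * runit_inv u) * (runit_val u * runit_val v) = 1.
Proof. by rewrite mulrA -[X in X * _]mulrA runitVK mulr1 runitVK. Qed.

Definition runit_mul u v : runit A := RUnit (runit_mulK u v) (runit_mulVK u v).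

Lemma gconjM u v g : gconj (runit_mul u v) g = gconj u (gconj v g).
Proof. by rewrite /gconj /= -scalerA ractA !ractZl. Qed.

Lemma gconjK u g : gconj (runit_swap u) (gconj u g) = g.
Proof.
by rewrite /gconj /= -ractZl scalerA runitVK scale1r -ractA runitVK ract1.
Qed.

Lemma conj_orbit_gconj u g : conj_orbit (gconj u g) = conj_orbit g.
Proof.
apply/seteqP; split=> [_ [v _ <-]|_ [v _ <-]].
  by exists (runit_mul v u); rewrite ?gconjM.
by exists (runit_mul v (runit_swap u)); rewrite ?gconjM ?gconjK.
Qed.

(** The map a ⊗ a' |-> a u ⊗ u^-1 a', meant for h = u g u^-1.  Both h and g are
kept as parameters, so that the inverse map is again of this form, with h and g
exchanged, although g is only propositionally equal to u^-1 h u. *)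
Definition can_dom_conj u h g : can_dom h -> can_dom g :=
  tens_lift (fun a a' =>
    tens _ _ (a * runit_val u) (runit_inv u * a') : can_dom g).

Section Transport.
Variables (u : runit A) (h g : C).
Hypothesis hE : h = gconj u g.

(** Conjugation by u^-1 carries A^h into A^g; this is what makes
[can_dom_conj] compatible with the two middle scalar rings. *)
Lemma cent_conj (b : cent_ring h) :
  runit_inv u * val b * runit_val u \in cent g.
Proof.
have ug : runit_val u *: g = h :* runit_val u.
  by rewrite hE /gconj -ractA runitVK ract1.
have gu : runit_inv u *: h = g :* runit_inv u.
  by rewrite hE /gconj ractZl scalerA runitVK scale1r.
rewrite inE; apply/eqP.
by rewrite -!scalerA ug -ractZl cent_ring_comm -!ractZl gu !ractA.
Qed.

Lemma can_dom_conj_balanced : balanced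
  (fun (a : A) (r : cent_ring h) => a * val r)
  (fun (r : cent_ring h) (a : A) => val r * a)
  (fun a a' => tens _ _ (a * runit_val u) (runit_inv u * a') : can_dom g).
Proof.
split=> [a a' b|a b b'|a r b]; first by rewrite mulrDl tensDl.
  by rewrite mulrDr tensDr.
have -> : a * val r * runit_val u =
    a * runit_val u * val (CentRing (cent_conj r)).
  by rewrite /= !mulrA -(mulrA a (runit_val u)) runitK mulr1.
rewrite tensA; congr (tens _ _ _ _).
by rewrite /= -!mulrA [runit_val u * _]mulrA runitK mul1r.
Qed.

Lemma can_dom_conjE a a' : can_dom_conj u g (tens _ _ a a' : can_dom h) =
  tens _ _ (a * runit_val u) (runit_inv u * a').
Proof. exact: tens_liftE can_dom_conj_balanced a a'. Qed.

Lemma can_dom_conjD (s t : can_dom h) :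
  can_dom_conj u g (s + t) = can_dom_conj u g s + can_dom_conj u g t.
Proof. exact: tens_liftD can_dom_conj_balanced s t. Qed.

Lemma can_dom_conj0 : can_dom_conj u g (0 : can_dom h) = 0.
Proof. exact: tens_lift0 can_dom_conj_balanced. Qed.

Lemma can_map_conj (t : can_dom h) : can_map (can_dom_conj u g t) = can_map t.
Proof.
move: t; apply: tensor_ind => [a a'||s t hs ht].
- by rewrite can_dom_conjE !can_mapE hE /gconj -!scalerA ractA !ractZl.
- rewrite can_dom_conj0 [LHS](tens_lift0 (can_balanced g)).
  by rewrite [RHS](tens_lift0 (can_balanced h)).
- rewrite can_dom_conjD [LHS](tens_liftD (can_balanced g)).
  by rewrite [RHS](tens_liftD (can_balanced h)); congr (_ + _).
Qed.

End Transport.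

Lemma can_dom_conjK u h g : h = gconj u g ->
  cancel (@can_dom_conj u h g) (@can_dom_conj (runit_swap u) g h).
Proof.
move=> hE; have gE : g = gconj (runit_swap u) h by rewrite hE gconjK.
apply: tensor_ind => [a a'||s t hs ht].
- rewrite (can_dom_conjE hE) (can_dom_conjE gE) /=.
  by rewrite -mulrA runitK mulr1 mulrA runitK mul1r.
- by rewrite (can_dom_conj0 hE) (can_dom_conj0 gE).
- by rewrite (can_dom_conjD hE) (can_dom_conjD gE) hs ht.
Qed.

Lemma gconj_Gal u g : Gal C g -> Gal C (gconj u g).
Proof.
move=> [gr can_bij]; split; first exact: gconj_grouplike.
set h := gconj u g; have hE : h = gconj u g by [].
have gE : g = gconj (runit_swap u) h by rewrite gconjK.
have conj_bij : bijective (@can_dom_conj u h g).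
  by exists (@can_dom_conj (runit_swap u) g h); apply: can_dom_conjK.
apply: (eq_bij (bij_comp can_bij conj_bij)) => t /=.
exact: can_map_conj.
Qed.

End Units.
End GaloisGrouplike.

(** * Conjugacy of all grouplike elements *)

Theorem theorem2p7 (K : comPzRingType) (A : algType K) (C : coringType A)
    (g : C) (gGal : Gal C g)
    (hA : (division_ring (cent_ring g) /\ (right_IBN A \/ left_IBN A))
          \/ division_ring A) :
  [/\ Gr C = Gal C, Gal C = conj_orbit g & D1 C = [set conj_orbit g]].
Proof.
have Gr_conj h : Gr C h -> exists u : runit A, h = gconj u g.
  move=> hgr; case: hA => [[divB ibn]|divA].
    exact: grouplike_conjugate_IBN gGal _ hgr divB ibn.
  have divB : division_ring (cent_ring g) by exact: division_ring_cent.
  exact: (grouplike_conjugate_division gGal hgr divB divA).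
split.
- apply/seteqP; split=> [h /Gr_conj [u ->]|h []//].
  exact: gconj_Gal.
- apply/seteqP; split=> [h [/Gr_conj [u ->] _]|_ [u _ <-]]; first by exists u.
  exact: gconj_Gal.
- apply/seteqP; split=> [_ [h /Gr_conj [u ->] <-]|_ ->].
    exact: conj_orbit_gconj.
  by exists g => //; case: gGal.
Qed.
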